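(* Suppose that a group $G$ acts geometrically on two CAT(0) spaces $X$ and $Y$. Let $x_0\in X$ and $y_0\in Y$. Assume that there exist constants $N>0$ and $M>0$ such that $G\,B(x_0,N)=X$, $G\,B(y_0,M)=Y$ and, for any $g,a\in G$, if $[x_0,gx_0]\cap B(ax_0,N)\neq\emptyset$ in $X$ then $[y_0,gy_0]\cap B(ay_0,M)\neq\emptyset$ in $Y$. Then there exists a $G$-equivariant homeomorphism $\bar\phi:\partial X\to\partial Y$ of the boundaries which is a continuous extension of the quasi-isometry $\phi:Gx_0\to Gy_0$ defined by $\phi(gx_0)=gy_0$.
   Context: A CAT(0) space is a proper geodesic metric space satisfying the CAT(0)-inequality for all geodesic triangles. A geometric action is an action by isometries that is proper (each point $x$ has some $r>0$ such that $\{g : gB(x,r)\cap B(x,r)\ne\emptyset\}$ is finite) and cocompact. $B(x,N)$ is the closed ball of radius $N$ about $x$, $G\,B(x,N)=\bigcup_{g\in G}gB(x,N)$, and $[p,q]$ is the geodesic segment from $p$ to $q$. The boundary $\partial X$ is the set of geodesic rays in $X$ modulo the relation that $\xi\sim\zeta$ iff the image of $\xi$ lies in a bounded neighbourhood of the image of $\zeta$. $X\cup\partial X$ carries the usual (cone) topology: $X$ is open, and for $\alpha\in\partial X$ with $\xi_\alpha$ the ray from $x_0$ to $\alpha$, and any fixed $\epsilon_0>0$, the sets $U(\alpha;r,\epsilon_0)=\{x\in X\cup\partial X : x\notin B(x_0,r),\ d_X(\xi_\alpha(r),\xi_x(r))<\epsilon_0\}$, $r>0$, form a neighbourhood basis at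 $\alpha$, where $\xi_x$ is the geodesic segment or ray from $x_0$ to $x$. The topology does not depend on $x_0$. $G$ acts on $\partial X$ by homeomorphisms induced from its action on geodesic rays. A map $\bar\phi:\partial X\to\partial Y$ is a continuous extension of $\phi:gx_0\mapsto gy_0$ if, whenever $\{g_i\}\subset G$ is a sequence such that $g_ix_0$ converges to $\alpha\in\partial X$ in $X\cup\partial X$, the sequence $g_iy_0$ converges to $\bar\phi(\alpha)$ in $Y\cup\partial Y$ (and $\bar\phi$ is continuous). *)

(* Defs.v *)
From HB Require Import structures.
From mathcomp Require Import all_boot all_order all_algebra.
From mathcomp Require Import generic_quotient ring lra.
From mathcomp Require Import all_classical all_reals all_analysis.

Set Implicit Arguments.
Unset Strict Implicit.
Unset Printing Implicit Defensive.

Import Order.TTheory GRing.Theory Num.Theory.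

Local Open Scope classical_set_scope.
Local Open Scope ring_scope.
Local Open Scope quotient_scope.

Section MetricNotions.
Context {R : realType} {T : metricType R}.

(* Not the library's [closed_ball], which is the closure of the open ball. *)
Definition cball (x : T) (r : R) : set T := [set y | mdist x y <= r].

(* [c] is only constrained on [0, d(x, y)]. *)
Definition geodesic_path (x y : T) (c : R -> T) : Prop :=
  [/\ c 0 = x, c (mdist x y) = y &
      {in `[0, mdist x y] &, forall s t, mdist (c s) (c t) = `|s - t|}].

(* The union of the images of all geodesics from [x] to [y]; in a CAT(0) space
   there is exactly one. *)
Definition geodesic_segment (x y : T) : set T :=
  [set z | exists2 c, geodesic_path x y c & exists2 t, t \in `[0, mdist x y] & c t = z].

End MetricNotions.

Section EuclideanPlane.
Context {R : realType}.

Definition eucl_dist (p q : 'rV[R]_2) : R :=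
  Num.sqrt (\sum_(i < 2) (p 0 i - q 0 i) ^+ 2).

Definition eucl_segment (p q : 'rV[R]_2) : set 'rV[R]_2 :=
  [set (1 - u) *: p + u *: q | u in `[0, 1]].

End EuclideanPlane.

(* The triangle has vertices [v i] and sides [c i] from [v i] to [v (i + 1)],
   with [i + 1] taken modulo 3; [w] is a comparison triangle, and [p] is the
   comparison point of [c i s]. *)
Definition cat0_inequality (R : realType) (T : metricType R) : Prop :=
  forall (v : 'I_3 -> T) (c : 'I_3 -> R -> T) (w : 'I_3 -> 'rV[R]_2),
    (forall i, geodesic_path (v i) (v (i + 1)) (c i)) ->
    (forall i, eucl_dist (w i) (w (i + 1)) = mdist (v i) (v (i + 1))) ->
  forall (i j : 'I_3) (s t : R) (p q : 'rV[R]_2),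
    s \in `[0, mdist (v i) (v (i + 1))] -> t \in `[0, mdist (v j) (v (j + 1))] ->
    eucl_segment (w i) (w (i + 1)) p -> eucl_dist (w i) p = s ->
    eucl_segment (w j) (w (j + 1)) q -> eucl_dist (w j) q = t ->
  mdist (c i s) (c j t) <= eucl_dist p q.

HB.mixin Record Metric_isCAT0 (R : realType) T & Metric R T := {
  cat0_proper : forall (x : T) (r : R), compact (cball x r);
  cat0_geodesic : forall x y : T, exists c : R -> T, geodesic_path x y c;
  cat0_ineq : cat0_inequality T
}.

#[short(type="cat0Type")]
HB.structure Definition CAT0 (R : realType) :=
  { T of Metric R T & Metric_isCAT0 R T }.

Section Fan.
Context {R : realType} {T : cat0Type R}.

Let vec (a b : R) : 'rV[R]_2 := \row_k (if k == 0 then a else b).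

Let eucl_dist_vec a b a' b' :
  eucl_dist (vec a b) (vec a' b') = Num.sqrt ((a - a') ^+ 2 + (b - b') ^+ 2).
Proof. by rewrite /eucl_dist !big_ord_recl big_ord0 !mxE /= addr0. Qed.

Let conv_vec u a b a' b' : (1 - u) *: vec a b + u *: vec a' b' =
  vec ((1 - u) * a + u * a') ((1 - u) * b + u * b').
Proof. by apply/rowP => k; rewrite !mxE; case: eqP. Qed.

Let sqrt_eq (x y : R) : 0 <= x -> y = x ^+ 2 -> Num.sqrt y = x.
Proof. by move=> x0 ->; rewrite sqrtr_sqr ger0_norm. Qed.

Let ord3P (P : 'I_3 -> Prop) : P 0 -> P 1 -> P (1 + 1) -> forall i, P i.
Proof.
move=> P0 P1 P2 [[|[|[|//]]] i3].
- by rewrite (_ : Ordinal i3 = 0)//; exact: val_inj.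
- by rewrite (_ : Ordinal i3 = 1)//; exact: val_inj.
- by rewrite (_ : Ordinal i3 = 1 + 1)//; exact: val_inj.
Qed.

(* The distance between two geodesics issuing from a point is nondecreasing. *)
Lemma cat0_fan (c d : R -> T) (r s : R) :
  0 <= r -> r <= s -> c 0 = d 0 ->
  {in `[0, s] &, forall t u, mdist (c t) (c u) = `|t - u|} ->
  {in `[0, s] &, forall t u, mdist (d t) (d u) = `|t - u|} ->
  mdist (c r) (d r) <= mdist (c s) (d s).
Proof.
move=> r0 rs cd0 ci di.
have [s0|s_le0] := ltP 0 s; last first.
  have -> : r = s by lra.
  exact: lexx.
have I0 : 0 \in `[0, s] by rewrite in_itv /= lexx ltW.
have Is : s \in `[0, s] by rewrite in_itv /= lexx ltW.
have cs : mdist (c 0) (c s) = s by rewrite ci// sub0r normrN gtr0_norm.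
have ds : mdist (d s) (c 0) = s by rewrite cd0 di// subr0 gtr0_norm.
set D := mdist (c s) (d s).
have D0 : 0 <= D by exact: mdist_ge0.
have D2 : D <= 2 * s.
  have := metric_triangle (c s) (c 0) (d s).
  by rewrite (metric_sym (c s) (c 0)) cs (metric_sym (c 0)) ds -/D; lra.
have [e [e0 eD ei]] := cat0_geodesic (c s) (d s).
pose h := Num.sqrt (s ^+ 2 - (D / 2) ^+ 2).
have hh : h ^+ 2 = s ^+ 2 - (D / 2) ^+ 2 by rewrite sqr_sqrtr//; nra.
pose pick (A : Type) (x y z : A) (i : 'I_3) :=
  if i == 0 then x else if i == 1 then y else z.
pose v := pick _ (c 0) (c s) (d s).
pose k := pick _ c e (fun t => d (s - t)).
pose w := pick _ (vec 0 0) (vec h (D / 2)) (vec h (- (D / 2))).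
have vk i : geodesic_path (v i) (v (i + 1)) (k i).
  elim/ord3P: i; split => //=; rewrite /v /k /pick /= ?cs ?ds ?subr0 ?subrr ?cd0//.
  move=> t u; rewrite !in_itv /= => /andP[t0 ts] /andP[u0 us].
  rewrite di ?in_itv /=; [|lra|lra].
  by rewrite distrC; congr (`|_|); ring.
have vw i : eucl_dist (w i) (w (i + 1)) = mdist (v i) (v (i + 1)).
  elim/ord3P: i; rewrite /v /w /pick /= eucl_dist_vec ?cs ?ds -/D.
  - by apply: sqrt_eq; [exact: ltW|rewrite -[s ^+ 2](subrK ((D / 2) ^+ 2)) -hh; ring].
  - by apply: sqrt_eq => //; field.
  - by apply: sqrt_eq; [exact: ltW|rewrite -[s ^+ 2](subrK ((D / 2) ^+ 2)) -hh; ring].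
pose a := r / s.
have as_ : a * s = r by rewrite /a divfK// gt_eqF.
have a0 : 0 <= a by rewrite divr_ge0// ltW.
have a1 : a <= 1 by rewrite ler_pdivrMr// mul1r.
have := @cat0_ineq R T v k w vk vw 0 (1 + 1) r (s - r)
  (vec (a * h) (a * (D / 2))) (vec (a * h) (- (a * (D / 2)))).
rewrite /v /k /w /pick /= cs ds subKr !in_itv /=.
have -> : eucl_dist (vec (a * h) (a * (D / 2))) (vec (a * h) (- (a * (D / 2)))) = a * D.
  by rewrite eucl_dist_vec; apply: sqrt_eq; [exact: mulr_ge0|field].
move=> H; apply: le_trans (H _ _ _ _ _ _) _.
- by rewrite r0 rs.
- lra.
- exists a; first by rewrite /= in_itv /= a0 a1.
  by rewrite conv_vec; congr vec; ring.
- rewrite eucl_dist_vec -as_; apply: sqrt_eq; first by rewrite as_.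
  by rewrite exprMn -[s ^+ 2](subrK ((D / 2) ^+ 2)) -hh; ring.
- exists (1 - a); first by rewrite /= in_itv /=; lra.
  by rewrite conv_vec; congr vec; ring.
- rewrite eucl_dist_vec -[in RHS]as_.
  have -> : s - a * s = (1 - a) * s by ring.
  apply: sqrt_eq; first by apply: mulr_ge0; lra.
  by rewrite exprMn -[s ^+ 2](subrK ((D / 2) ^+ 2)) -hh; ring.
- by rewrite ler_piMl.
Qed.

End Fan.

Section Rays.
Context {R : realType} (X : cat0Type R).

(* Only the values on [0, +oo[ matter: the boundary forgets the others. *)
Record ray := Ray {
  ray_fun :> R -> X;
  ray_isom : forall s t, 0 <= s -> 0 <= t -> mdist (ray_fun s) (ray_fun t) = `|s - t|
}.

HB.instance Definition _ := gen_eqMixin ray.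
HB.instance Definition _ := gen_choiceMixin ray.

Definition asymptotic (xi zeta : ray) : Prop :=
  exists K : R, forall s, 0 <= s -> exists2 t, 0 <= t & mdist (xi s) (zeta t) <= K.

Lemma asymptotic_refl xi : asymptotic xi xi.
Proof. by exists 0 => s s0; exists s => //; rewrite mdistxx. Qed.

Lemma asymptotic_sym xi zeta : asymptotic xi zeta -> asymptotic zeta xi.
Proof.
move=> [K hK]; exists (K + (K + mdist (zeta 0) (xi 0))) => s s0; exists s => //.
have [t t0 xt] := hK _ s0.
rewrite metric_sym; apply: le_trans (metric_triangle _ (zeta t) _) _.
apply: lerD => //; rewrite ray_isom// distrC.
have ds : mdist (xi 0) (xi s) = s by rewrite ray_isom// sub0r normrN ger0_norm.
have dt : mdist (zeta 0) (zeta t) = t by rewrite ray_isom// sub0r normrN ger0_norm.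
have h1 := metric_triangle (xi 0) (zeta t) (xi s).
have h2 := metric_triangle (xi 0) (zeta 0) (zeta t).
have h3 := metric_triangle (zeta 0) (xi s) (zeta t).
have h4 := metric_triangle (zeta 0) (xi 0) (xi s).
have := (metric_sym (zeta t) (xi s), metric_sym (xi 0) (zeta 0)).
by move=> [e1 e2]; rewrite ler_norml; apply/andP; split; lra.
Qed.

Lemma asymptotic_trans xi zeta chi :
  asymptotic xi zeta -> asymptotic zeta chi -> asymptotic xi chi.
Proof.
move=> [K hK] [L hL]; exists (K + L) => s /hK[t /hL[u u0 tu] st].
by exists u => //; apply: le_trans (metric_triangle _ (zeta t) _) _; apply: lerD.
Qed.

Definition asymptoticb (xi zeta : ray) : bool := `[< asymptotic xi zeta >].

Lemma asymptoticb_equiv : equiv_class_of asymptoticb.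
Proof.
split=> [xi|xi zeta|zeta xi chi].
- by apply/asboolP; exact: asymptotic_refl.
- by apply/asboolP/asboolP; exact: asymptotic_sym.
- by move=> /asboolP xz /asboolP zc; apply/asboolP; exact: asymptotic_trans zc.
Qed.

Canonical asymptotic_rel := EquivRelPack asymptoticb_equiv.

Definition boundary : Type := {eq_quot asymptotic_rel}.

HB.instance Definition _ := Choice.on boundary.

Definition ray_class (xi : ray) : boundary := \pi_({eq_quot asymptotic_rel}) xi.

Lemma ray_classP xi zeta : ray_class xi = ray_class zeta <-> asymptotic xi zeta.
Proof.
split=> [/eqquotP /asboolP //|xz].
by apply/eqquotP/asboolP.
Qed.

End Rays.

Arguments ray_class {R X} xi.

Section ConeTopology.
Context {R : realType} (X : cat0Type R).

(* The space X u dX, with the cone topology based at [x0]. *)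
Definition bordification (x0 : X) : Type := (X + boundary X)%type.

Variable x0 : X.

Definition path_to (x : bordification x0) (c : R -> X) : Prop :=
  match x with
  | inl p => geodesic_path x0 p c
  | inr alpha => exists xi : ray X, [/\ xi 0 = x0, ray_class xi = alpha & c = xi]
  end.

(* U(alpha; r, e). In a CAT(0) space [c] and [c'] exist and their values at [r]
   are uniquely determined. *)
Definition cone_nbhd (alpha : boundary X) (r e : R) : set (bordification x0) :=
  [set x | (forall p, x = inl p -> ~ cball x0 r p) /\
           exists c c', [/\ path_to (inr alpha) c, path_to x c' &
                            mdist (c r) (c' r) < e]].

(* The sets U(alpha; r, e0), r > 0, with e0 fixed, define the same topology for
   every e0 > 0; here e0 = 1. *)
Definition cone_open (O : set (bordification x0)) : Prop :=
  open [set p : X | O (inl p)] /\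
  forall alpha, O (inr alpha) -> exists2 r, 0 < r & cone_nbhd alpha r 1 `<=` O.

Lemma path_to_isom x c r : 0 <= r -> path_to x c ->
    (forall p, x = inl p -> ~ cball x0 r p) ->
  c 0 = x0 /\ {in `[0, r] &, forall s t, mdist (c s) (c t) = `|s - t|}.
Proof.
move=> r0; case: x => [p [c0 _ ci] /(_ p erefl)/negP|alpha [xi [xi0 _ ->]] _].
  rewrite /cball /= -ltNge => rp; split=> // s t.
  rewrite !in_itv /= => /andP[s0 sr] /andP[t0 tr].
  by apply: ci; rewrite in_itv /= ?s0 ?t0 /= (le_trans _ (ltW rp)).
split=> // s t; rewrite !in_itv /= => /andP[s0 _] /andP[t0 _].
exact: ray_isom.
Qed.

Lemma cone_nbhd_le alpha r r' e : 0 < r -> r <= r' ->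
  cone_nbhd alpha r' e `<=` cone_nbhd alpha r e.
Proof.
move=> r0 rr' x [xr' [c [c' [cP c'P cc']]]]; have r'0 := lt_le_trans r0 rr'.
split=> [p /xr' + xp|]; first by apply; exact: le_trans xp rr'.
exists c, c'; split=> //; apply: le_lt_trans cc'.
have [//|c0 ci] := path_to_isom (ltW r'0) cP.
have [c'0 c'i] := path_to_isom (ltW r'0) c'P xr'.
by apply: cat0_fan (ltW r0) rr' _ ci c'i; rewrite c0 c'0.
Qed.

Lemma cone_openT : cone_open setT.
Proof. by split=> [|alpha _]; [exact: openT|exists 1]. Qed.

Lemma cone_openI : setI_closed cone_open.
Proof.
move=> A B [oA hA] [oB hB]; split=> [|alpha [/hA[r r0 rA] /hB[s s0 sB]]].
  exact: openI.
exists (Num.max r s); first by rewrite lt_max r0.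
move=> x hx; split.
  by apply/rA/(cone_nbhd_le r0 _ hx); rewrite le_max lexx.
by apply/sB/(cone_nbhd_le s0 _ hx); rewrite le_max lexx orbT.
Qed.

Lemma cone_open_bigU (I : Type) (f : I -> set (bordification x0)) :
  (forall i, cone_open (f i)) -> cone_open (\bigcup_i f i).
Proof.
move=> fo; split=> [|alpha [i _ /(fo i).2[r r0 rf]]].
  have -> : [set p : X | (\bigcup_i f i) (inl p)] =
            \bigcup_i [set p : X | f i (inl p)] by [].
  by apply: bigcup_open => i _; exact: (fo i).1.
by exists r => // x /rf; exists i.
Qed.

HB.instance Definition _ := Choice.on (bordification x0).
HB.instance Definition _ :=
  isOpenTopological.Build (bordification x0) cone_openT cone_openI cone_open_bigU.

(* The boundary, as a subspace of the bordification. *)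
Definition cone_boundary : Type :=
  initial_topology (inr : boundary X -> bordification x0).

HB.instance Definition _ := Topological.on cone_boundary.

End ConeTopology.

Section Actions.
Context {R : realType} {G : groupType}.

Record isometric_action (X : metricType R) := IsometricAction {
  act :> G -> X -> X;
  act1 : forall x, act 1%g x = x;
  actM : forall g h x, act (g * h)%g x = act g (act h x);
  act_isom : forall g x y, mdist (act g x) (act g y) = mdist x y
}.

Definition proper_action (X : metricType R) (a : isometric_action X) : Prop :=
  forall x, exists2 r : R, 0 < r &
    finite_set [set g | a g @` cball x r `&` cball x r !=set0].

Definition translates (X : metricType R) (a : isometric_action X) (A : set X) : set X :=
  \bigcup_g (a g @` A).

Definition cocompact_action (X : metricType R) (a : isometric_action X) : Prop :=
  exists2 K : set X, compact K & translates a K = setT.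

Definition geometric_action (X : metricType R) (a : isometric_action X) : Prop :=
  proper_action a /\ cocompact_action a.

Section BoundaryAction.
Variables (X : cat0Type R) (a : isometric_action X).

Lemma ray_act_isom g (xi : ray X) s t : 0 <= s -> 0 <= t ->
  mdist (a g (xi s)) (a g (xi t)) = `|s - t|.
Proof. by move=> s0 t0; rewrite act_isom ray_isom. Qed.

Definition ray_act g (xi : ray X) : ray X := Ray (@ray_act_isom g xi).

Definition boundary_act g (alpha : boundary X) : boundary X :=
  ray_class (ray_act g (repr alpha)).

Lemma boundary_act_class g xi :
  boundary_act g (ray_class xi) = ray_class (ray_act g xi).
Proof.
apply/ray_classP.
have /ray_classP[K hK] : ray_class (repr (ray_class xi)) = ray_class xi.
  exact: reprK.
by exists K => s /hK[t t0 st]; exists t => //=; rewrite act_isom.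
Qed.

End BoundaryAction.

Section OrbitMap.
Context {X Y : cat0Type R}.
Variables (aX : isometric_action X) (aY : isometric_action Y) (x0 : X) (y0 : Y).

(* As the stabilizer of [x0] need not fix [y0], the map g x0 |-> g y0 may be
   multivalued, and is represented by the pairs (g x0, g y0); it is onto the
   orbit of [y0] by construction. *)
Definition orbit_map_quasi_isometry : Prop :=
  exists L C : R, [/\ 1 <= L, 0 <= C & forall g h,
    L^-1 * mdist (aX g x0) (aX h x0) - C <= mdist (aY g y0) (aY h y0) /\
    mdist (aY g y0) (aY h y0) <= L * mdist (aX g x0) (aX h x0) + C].

Definition boundary_equivariant (phi : cone_boundary x0 -> cone_boundary y0) : Prop :=
  forall g alpha, phi (boundary_act aX g alpha) = boundary_act aY g (phi alpha).

Definition continuous_extension (phi : cone_boundary x0 -> cone_boundary y0) : Prop :=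
  continuous phi /\
  forall (g : nat -> G) (alpha : boundary X),
    (inl (aX (g i) x0) : bordification x0) @[i --> \oo]
      --> (inr alpha : bordification x0) ->
    (inl (aY (g i) y0) : bordification y0) @[i --> \oo]
      --> (inr (phi alpha) : bordification y0).

End OrbitMap.
End Actions.

Arguments isometric_action {R} G X.

Definition homeomorphism (S T : topologicalType) (f : S -> T) : Prop :=
  continuous f /\ exists g : T -> S, [/\ cancel f g, cancel g f & continuous g].

(* Main.v *)
Require Import Defs.
From mathcomp Require Import all_boot all_order all_algebra.
From mathcomp Require Import ring lra.
From mathcomp Require Import all_classical all_reals all_analysis.

(** A geodesic [c] from [x0] to [g x0] and a geodesic [eta] from [y0] to [g y0]
    are related by the orbits: every [c s] is close to some [b x0] for which [b y0]
    is close to a point of [eta], a shadow of [c s].  The orbit map is a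
    quasi-isometry ([orbit_map_coarsely_lipschitz], used in both directions), so
    nearby points have nearby shadows, and points far from [x0] have shadows far
    from [y0].

    In a CAT(0) space two geodesics issuing from [y0] that are boundedly close at a
    large distance [t] are [O(r / t)]-close at a fixed distance [r]
    ([cat0_fan_min]).  Hence if [c] and [c'] agree up to a unit error far away from
    [x0], the geodesics [eta] and [eta'] carrying the shadows almost agree at [r]
    ([shadows_close]).  This single estimate gives everything about the map sending
    a ray from [x0] to the ray from [y0] that shadows it: the shadowing ray is
    unique ([ray_shadow_uniq]), and the map is continuous and extends the orbit map
    ([boundary_map_exists]).  Its existence is a compactness argument
    ([ray_shadow_exists]).  Shadowing makes sense for rays with any origin and is
    preserved by the group, whence the equivariance.

    The map is a homeomorphism because the hypothesis is in fact symmetric: the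
    shadows of a unit-step chain of points of [c] leave no large gap on [eta], so
    every point of [eta] has a shadow on [c] ([orbit_tracking_sym]).  The extension
    obtained from [Y] to [X] is the inverse, since both maps send the limit of
    [g n x0], resp. [g n y0], to the limit of the other sequence
    ([continuous_extension_cancel]). *)

Set Implicit Arguments.
Unset Strict Implicit.
Unset Printing Implicit Defensive.

Import Order.TTheory GRing.Theory Num.Theory.

Local Open Scope classical_set_scope.
Local Open Scope ring_scope.

(** * Geodesics issuing from a common point *)

Section Geodesics.
Context {R : realType} {T : cat0Type R}.
Implicit Types (c d : R -> T) (x : T) (r s u v : R).

(** Common to the segments of length at least [s] and to the rays from [x]. *)
Definition geodesic_from x s c : Prop :=
  c 0 = x /\ {in `[0, s] &, forall t u, mdist (c t) (c u) = `|t - u|}.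

Lemma geodesic_from_dist x s c t u : geodesic_from x s c ->
  0 <= t <= s -> 0 <= u <= s -> mdist (c t) (c u) = `|t - u|.
Proof. by move=> [_ ci] ht hu; apply: ci; rewrite in_itv. Qed.

Lemma geodesic_from_dist0 x s c t : geodesic_from x s c ->
  0 <= t <= s -> mdist x (c t) = t.
Proof.
move=> cP /[dup] ht /andP[t0 ts]; have [<- _] := cP.
by rewrite (geodesic_from_dist cP) ?lexx ?(le_trans t0)// sub0r normrN ger0_norm.
Qed.

Lemma geodesic_from_le x r s c : r <= s -> geodesic_from x s c -> geodesic_from x r c.
Proof.
move=> rs [c0 ci]; split=> // t u; rewrite !in_itv /= => /andP[t0 tr] /andP[u0 ur].
by apply: ci; rewrite in_itv /= ?t0 ?u0 /= (le_trans _ rs).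
Qed.

Lemma geodesic_path_from x y c : geodesic_path x y c -> geodesic_from x (mdist x y) c.
Proof. by case. Qed.

Lemma ray_geodesic_from (xi : ray T) s : geodesic_from (xi 0) s xi.
Proof.
split=> // t u; rewrite !in_itv /= => /andP[t0 _] /andP[u0 _]; exact: ray_isom.
Qed.

Let vec (a b : R) : 'rV[R]_2 := \row_k (if k == 0 then a else b).

Let eucl_dist_vec a b a' b' :
  eucl_dist (vec a b) (vec a' b') = Num.sqrt ((a - a') ^+ 2 + (b - b') ^+ 2).
Proof. by rewrite /eucl_dist !big_ord_recl big_ord0 !mxE /= addr0. Qed.

Let vec_segment u a b a' b' : 0 <= u <= 1 ->
  eucl_segment (vec a b) (vec a' b')
    (vec ((1 - u) * a + u * a') ((1 - u) * b + u * b')).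
Proof.
move=> u01; exists u; first by rewrite /= in_itv.
by apply/rowP => k; rewrite !mxE; case: eqP.
Qed.

Let sqrt_eq (a b : R) : 0 <= a -> b = a ^+ 2 -> Num.sqrt b = a.
Proof. by move=> a0 ->; rewrite sqrtr_sqr ger0_norm. Qed.

(** The comparison triangle is isosceles, and the comparison points cut its two
    equal sides in the ratio [r / s], so that they span a scaled copy of its base. *)
Lemma cat0_fan_scaled x c d r s : 0 <= r <= s ->
  geodesic_from x s c -> geodesic_from x s d ->
  s * mdist (c r) (d r) <= r * mdist (c s) (d s).
Proof.
move=> /andP[r0 rs] cP dP.
have [s0|s_le0] := ltP 0 s; last first.
  have -> : r = s by lra.
  exact: lexx.
have ss : 0 <= s <= s by rewrite lexx ltW.
have xc := geodesic_from_dist0 cP ss; have xd := geodesic_from_dist0 dP ss.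
set D := mdist (c s) (d s).
have D0 : 0 <= D by exact: mdist_ge0.
have D2 : D <= 2 * s.
  by have := metric_triangle (c s) x (d s); rewrite (metric_sym (c s) x) xc xd -/D; lra.
have [e [e0 eD ei]] := cat0_geodesic (c s) (d s).
(* the altitude of the comparison triangle *)
pose h := Num.sqrt (s ^+ 2 - (D / 2) ^+ 2).
have sE : s ^+ 2 = h ^+ 2 + (D / 2) ^+ 2 by rewrite sqr_sqrtr ?subrK//; nra.
pose pick (A : Type) (y0 y1 y2 : A) (i : 'I_3) :=
  if i == 0 then y0 else if i == 1 then y1 else y2.
pose V := pick _ x (c s) (d s).
pose k := pick _ c e (fun t => d (s - t)).
pose W := pick _ (vec 0 0) (vec h (D / 2)) (vec h (- (D / 2))).
have i3P (P : 'I_3 -> Prop) : P 0 -> P 1 -> P (1 + 1) -> forall i, P i.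
  move=> P0 P1 P2 [[|[|[|//]]] i3].
  - by rewrite (_ : Ordinal i3 = 0)//; exact: val_inj.
  - by rewrite (_ : Ordinal i3 = 1)//; exact: val_inj.
  - by rewrite (_ : Ordinal i3 = 1 + 1)//; exact: val_inj.
have dx : mdist (d s) x = s by rewrite metric_sym.
have Vk i : geodesic_path (V i) (V (i + 1)) (k i).
  elim/i3P: i; split => //=; rewrite /V /k /pick /= ?xc ?dx ?subr0 ?subrr//.
  - exact: cP.1.
  - exact: cP.2.
  - exact: dP.1.
  - move=> t u; rewrite !in_itv /= => /andP[t0 ts] /andP[u0 us].
    rewrite (geodesic_from_dist dP); [|lra|lra].
    by rewrite distrC; congr (`|_|); ring.
have VW i : eucl_dist (W i) (W (i + 1)) = mdist (V i) (V (i + 1)).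
  elim/i3P: i; rewrite /V /W /pick /= eucl_dist_vec ?xc ?dx -/D.
  - by apply: sqrt_eq; [exact: ltW|rewrite sE; ring].
  - by apply: sqrt_eq => //; field.
  - by apply: sqrt_eq; [exact: ltW|rewrite sE; ring].
pose a := r / s.
have rE : r = a * s by rewrite /a divfK// gt_eqF.
have a0 : 0 <= a by rewrite divr_ge0// ltW.
have a1 : a <= 1 by rewrite ler_pdivrMr// mul1r.
have := @cat0_ineq R T V k W Vk VW 0 (1 + 1) r (s - r)
  (vec (a * h) (a * (D / 2))) (vec (a * h) (- (a * (D / 2)))).
rewrite /V /k /W /pick /= xc dx subKr !in_itv /=.
have -> : eucl_dist (vec (a * h) (a * (D / 2))) (vec (a * h) (- (a * (D / 2)))) = a * D.
  by rewrite eucl_dist_vec; apply: sqrt_eq; [exact: mulr_ge0|field].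
move=> H; have -> : r * D = s * (a * D) by rewrite {1}rE; ring.
rewrite ler_pM2l //; apply: H.
- lra.
- lra.
- have := @vec_segment a 0 0 h (D / 2).
  rewrite !mulr0 !add0r; apply; lra.
- rewrite eucl_dist_vec; apply: sqrt_eq => //.
  by rewrite rE exprMn sE; ring.
- have := @vec_segment (1 - a) h (- (D / 2)) 0 0.
  rewrite !mulr0 !addr0 subKr mulrN; apply; lra.
- rewrite eucl_dist_vec.
  have -> : s - r = (1 - a) * s by rewrite rE; ring.
  apply: sqrt_eq; first by apply: mulr_ge0; lra.
  by rewrite exprMn sE; ring.
Qed.

(** Moving the farther of [c u] and [d v] back to the distance of the nearer one
    from the basepoint at most doubles their distance. *)
Lemma cat0_fan_min x c d r u v : 0 <= r -> r <= u -> r <= v ->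
  geodesic_from x u c -> geodesic_from x v d ->
  Num.min u v * mdist (c r) (d r) <= 2 * r * mdist (c u) (d v).
Proof.
move=> r0.
wlog uv : c d u v / u <= v.
  move=> W ru rv cP dP; have [uv|/ltW vu] := leP u v.
    by have := W c d u v uv ru rv cP dP; rewrite min_l.
  have := W d c v u vu rv ru dP cP.
  by rewrite min_l // (metric_sym (d r)) (metric_sym (d v)).
move=> ru rv cP dP; rewrite min_l //.
have ruu : 0 <= r <= u by rewrite r0.
apply: le_trans (cat0_fan_scaled ruu cP (geodesic_from_le uv dP)) _.
rewrite -mulrA mulrCA; apply: ler_wpM2l => //.
have uu : 0 <= u <= u by rewrite lexx (le_trans r0).
have uv' : 0 <= u <= v by rewrite uv (le_trans r0).
have vv : 0 <= v <= v by rewrite lexx (le_trans r0).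
have h1 := geodesic_from_dist0 cP uu.
have h2 := geodesic_from_dist0 dP vv.
have h3 := geodesic_from_dist dP vv uv'.
have h4 := metric_triangle x (c u) (d v).
have h5 := metric_triangle (c u) (d v) (d u).
rewrite ger0_norm in h3; lra.
Qed.

Lemma cat0_fan_lt x c d r u v D : 0 <= r -> r <= u -> r <= v ->
  geodesic_from x u c -> geodesic_from x v d ->
  mdist (c u) (d v) <= D -> 2 * r * D < u -> 2 * r * D < v ->
  mdist (c r) (d r) < 1.
Proof.
move=> r0 ru rv cP dP cdD Du Dv.
have m0 : 2 * r * D < Num.min u v by rewrite lt_min Du.
have rD : 2 * r * mdist (c u) (d v) <= 2 * r * D by rewrite ler_wpM2l// mulr_ge0.
have rD0 : 0 <= 2 * r * mdist (c u) (d v) by rewrite !mulr_ge0// mdist_ge0.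
have H := cat0_fan_min r0 ru rv cP dP.
rewrite ltNge; apply/negP => x1.
have : Num.min u v <= Num.min u v * mdist (c r) (d r) by rewrite ler_peMr//; lra.
lra.
Qed.

Lemma geodesic_from_uniq x c d u r : 0 <= r <= u ->
  geodesic_from x u c -> geodesic_from x u d -> c u = d u -> c r = d r.
Proof.
move=> /[dup] ru /andP[r0 rleu] cP dP cd; apply: mdist_positivity.
have [u0|u0] := ltP 0 u; last first.
  have -> : r = u by lra.
  by rewrite cd mdistxx.
have := cat0_fan_scaled ru cP dP; rewrite cd mdistxx.
have := mdist_ge0 (c r) (d r); nra.
Qed.

(** The point [xi s] is within a constant of some [zeta t] with [t] close to [s], so
    the fan estimate at [r] tends to 0 as [s] grows. *)
Lemma asymptotic_rays_eq (xi zeta : ray T) : xi 0 = zeta 0 -> asymptotic xi zeta ->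
  forall r, 0 <= r -> xi r = zeta r.
Proof.
move=> e0 [K hK] r r0; apply: mdist_positivity; apply/eqP.
rewrite eq_le mdist_ge0 andbT leNgt; apply/negP => m0.
set m := mdist _ _ in m0.
have K0 : 0 <= K by have [t _ h] := hK 0 (lexx 0); exact: le_trans (mdist_ge0 _ _) h.
pose s := K + r + 2 * r * K / m + 1.
have q0 : 0 <= 2 * r * K / m by rewrite divr_ge0 ?(ltW m0)// !mulr_ge0.
have s0 : 0 <= s by rewrite /s; lra.
have [t t0 st] := hK _ s0.
have tl : `|s - t| <= K.
  have h1 : mdist (xi 0) (xi s) = s.
    by apply: (geodesic_from_dist0 (ray_geodesic_from xi s)); rewrite s0 lexx.
  have h2 : mdist (zeta 0) (zeta t) = t.
    by apply: (geodesic_from_dist0 (ray_geodesic_from zeta t)); rewrite t0 lexx.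
  have := metric_triangle (xi 0) (zeta t) (xi s).
  have := metric_triangle (xi 0) (xi s) (zeta t).
  rewrite (metric_sym (zeta t)) h1 e0 h2 => a b.
  by rewrite ler_norml; apply/andP; split; lra.
move: tl; rewrite ler_norml => /andP[tl1 tl2].
have rs : r <= s by rewrite /s; lra.
have rt : r <= t by move: tl2; rewrite /s; lra.
have := cat0_fan_min r0 rs rt (ray_geodesic_from xi s).
rewrite e0 => /(_ zeta (ray_geodesic_from zeta t)) /=; rewrite -/m => H.
have : 2 * r * K / m < Num.min s t.
  by rewrite lt_min /s; apply/andP; split; move: tl2; rewrite /s; lra.
rewrite ltr_pdivrMr // => /lt_le_trans/(_ H).
by have := mdist_ge0 (xi s) (zeta t); nra.
Qed.

Lemma asymptotic_bounded (xi zeta : ray T) K :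
  (forall r, 0 <= r -> mdist (xi r) (zeta r) <= K) -> asymptotic xi zeta.
Proof. by move=> h; exists K => s s0; exists s => //; exact: h. Qed.

End Geodesics.

(** * Limits of geodesics *)

Lemma ultra_compact_cvg (I : Type) (T : topologicalType) (U : set_system I)
    {UU : UltraFilter U} (f : I -> T) (A : set T) :
  compact A -> U (f @^-1` A) ->
  exists y : T, f @ U --> y.
Proof.
move=> cA UA; have [y [_ cy]] := cA (f @ U) _ UA.
exists y => B yB; have [//|UB] := in_ultra_setVsetC (f @^-1` B) UU.
by have [z []] := cy (~` B) B UB yB.
Qed.

Section Limits.
Context {R : realType} {T : cat0Type R}.

(** A pointwise limit of the [c n] along an ultrafilter: closed balls are compact,
    so every [c^~ t] converges along it. *)
Lemma geodesics_subconverge (x : T) (l : nat -> R) (c : nat -> R -> T) :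
  (forall n, geodesic_from x (l n) (c n)) ->
  (forall r, \forall n \near \oo, r <= l n) ->
  exists2 xi : ray T, xi 0 = x &
    forall r (P : set nat), 0 <= r -> (\forall n \near \oo, P n) ->
    exists n, [/\ P n, r <= l n & mdist (xi r) (c n r) < 1].
Proof.
move=> cP loo; have [U [UU sU]] := ultraFilterLemma eventually_filter.
have /choice[xi xiP] : forall r : R, exists y : T, 0 <= r -> c^~ r @ U --> y.
  move=> r; have [r0|r0] := leP 0 r; last by exists x.
  have [y yP] : exists y : T, c^~ r @ U --> y; last by exists y.
  apply: ultra_compact_cvg (cat0_proper x r) _.
  apply: filterS (sU _ (loo r)) => n rl.
  by rewrite /cball /= (geodesic_from_dist0 (cP n)) ?r0.
have xi_near r e : 0 <= r -> 0 < e -> \forall n \near U, mdist (xi r) (c n r) < e.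
  by move=> r0 e0; exact: metricType_numDomainType.cvgr_dist_lt (xiP r r0) e e0.
have xi_isom s t : 0 <= s -> 0 <= t -> mdist (xi s) (xi t) = `|s - t|.
  move=> s0 t0; apply/eqP; rewrite -subr_eq0 -normr_eq0 eq_le normr_ge0 andbT.
  apply/ler_addgt0Pl => e e0; rewrite addr0.
  have e2 : 0 < e / 2 by rewrite divr_gt0.
  have /filter_ex[n [[ns nt] [sl tl]]] : \forall n \near U,
      (mdist (xi s) (c n s) < e / 2 /\ mdist (xi t) (c n t) < e / 2) /\
      (s <= l n /\ t <= l n).
    by apply: filterI; apply: filterI; [exact: xi_near|exact: xi_near|
      exact: sU (loo s)|exact: sU (loo t)].
  rewrite -(@geodesic_from_dist _ _ _ _ _ s t (cP n)) ?s0 ?t0//.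
  have h1 := metric_triangle (xi s) (c n s) (xi t).
  have h2 := metric_triangle (c n s) (c n t) (xi t).
  have h3 := metric_triangle (c n s) (xi s) (c n t).
  have h4 := metric_triangle (xi s) (xi t) (c n t).
  rewrite (metric_sym (c n t) (xi t)) in h2; rewrite (metric_sym (c n s) (xi s)) in h3.
  by rewrite ler_norml; apply/andP; split; lra.
exists (Ray xi_isom) => /=.
  apply: mdist_positivity; apply/eqP; rewrite eq_le mdist_ge0 andbT.
  apply/ler_addgt0Pl => e e0; rewrite addr0.
  by have /filter_ex[n] := xi_near 0 e (lexx 0) e0; rewrite (cP n).1 => /ltW.
move=> r P r0 Poo.
have /filter_ex[n [[Pn rl] xn]] : \forall n \near U,
    (P n /\ r <= l n) /\ mdist (xi r) (c n r) < 1.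
  apply: filterI; last exact: xi_near.
  by apply: filterI; [exact: sU Poo|exact: sU (loo r)].
by exists n.
Qed.

(** The ray is a limit of the geodesics from [x] to [zeta n].  Read backwards from
    [zeta n], such a geodesic and [zeta] issue from the same point, so they stay
    within a bounded distance of each other. *)
Lemma asymptotic_ray_from (x : T) (alpha : boundary T) :
  exists2 xi : ray T, xi 0 = x & ray_class xi = alpha.
Proof.
rewrite -[alpha]reprK; move: (repr alpha) => zeta {alpha}.
set D := mdist x (zeta 0).
pose l n := mdist x (zeta n%:R).
have zn n : mdist (zeta 0) (zeta n%:R) = n%:R by rewrite ray_isom// sub0r normrN ger0_norm.
have lD n : n%:R - D <= l n <= n%:R + D.
  have h1 := metric_triangle (zeta 0) x (zeta n%:R).
  have h2 := metric_triangle x (zeta 0) (zeta n%:R).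
  move: h1 h2; rewrite (metric_sym (zeta 0) x) zn -/(l n) -/D; lra.
have /choice[c cP] : forall n, exists c, geodesic_path x (zeta n%:R) c.
  by move=> n; exact: cat0_geodesic.
have cP' n : geodesic_from x (l n) (c n) := geodesic_path_from (cP n).
have [|xi xi0 xiP] := geodesics_subconverge cP'.
  move=> r; apply: filterS (nbhs_infty_ger (r + D)) => n.
  by case/andP: (lD n) => *; lra.
exists xi => //; apply/ray_classP; apply: (@asymptotic_bounded _ _ _ _ (1 + 3 * D)).
move=> r r0.
have D0 : 0 <= D := mdist_ge0 _ _.
have xr : mdist x (xi r) = r.
  by rewrite -xi0 (geodesic_from_dist0 (ray_geodesic_from xi r))// r0 lexx.
have zr : mdist (zeta 0) (zeta r) = r.
  by rewrite (geodesic_from_dist0 (ray_geodesic_from zeta r))// r0 lexx.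
have [rD|Dr] := leP r D.
  have h1 := metric_triangle (xi r) x (zeta r).
  have h2 := metric_triangle x (zeta 0) (zeta r).
  by move: h1 h2; rewrite (metric_sym (xi r) x) xr zr -/D; lra.
have [n [rn rl xn]] := xiP r _ r0 (nbhs_infty_ger (r + D)).
have /andP[lD1 lD2] := lD n.
(* the geodesics read backwards from zeta n *)
pose back (u : R) (d : R -> T) := fun t => d (u - t).
have backP u d : geodesic_from (d 0) u d -> geodesic_from (d u) u (back u d).
  move=> dP; split=> [|s t]; rewrite /back ?subr0//.
  rewrite !in_itv /= => hs ht; rewrite (geodesic_from_dist dP); [|lra|lra].
  by rewrite distrC; congr (`|_|); ring.
have c0 : c n 0 = x := (cP' n).1.
have cl : c n (l n) = zeta n%:R by have [] := cP n.
have bc : geodesic_from (zeta n%:R) (l n) (back (l n) (c n)).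
  by rewrite -cl; apply: backP; rewrite c0.
have bz : geodesic_from (zeta n%:R) n%:R (back n%:R zeta).
  by apply: backP; exact: ray_geodesic_from.
have h1 : mdist (c n r) (zeta (n%:R - (l n - r))) <= 2 * D.
  have m0 : 0 < Num.min (l n) n%:R by rewrite lt_min; apply/andP; split; lra.
  rewrite -(ler_pM2l m0).
  have lr0 : 0 <= l n - r by lra.
  have lrl : l n - r <= l n by lra.
  have lrn : l n - r <= n%:R by lra.
  have := cat0_fan_min lr0 lrl lrn bc bz.
  rewrite /back subKr !subrr c0 -/D => /le_trans; apply.
  rewrite mulrCA -mulrA ler_pM2l// ler_wpM2r// le_min lrl /=; lra.
have h2 : mdist (zeta (n%:R - (l n - r))) (zeta r) <= D.
  by rewrite ray_isom//; [rewrite ler_norml; apply/andP; split; lra|lra].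
have h3 := metric_triangle (xi r) (c n r) (zeta r).
have h4 := metric_triangle (c n r) (zeta (n%:R - (l n - r))) (zeta r).
lra.
Qed.

End Limits.

(** * The cone topology *)

Section Cone.
Context {R : realType} {X : cat0Type R} (x0 : X).
Implicit Types (alpha beta : boundary X) (x : bordification x0) (c d : R -> X).

Lemma path_to_exists x : exists c, path_to x c.
Proof.
case: x => [p|alpha]; first exact: cat0_geodesic.
by have [xi xi0 xia] := asymptotic_ray_from x0 alpha; exists xi, xi.
Qed.

Lemma path_to_from x c r : 0 <= r -> path_to x c ->
  (forall p, x = inl p -> ~ cball x0 r p) -> geodesic_from x0 r c.
Proof. exact: path_to_isom. Qed.

Lemma path_to_uniq x c d r : 0 <= r ->
    (forall p, x = inl p -> ~ cball x0 r p) ->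
  path_to x c -> path_to x d -> c r = d r.
Proof.
move=> r0; case: x => [p /(_ p erefl)/negP|alpha _].
  rewrite /cball /= -ltNge => rp cP dP.
  apply: (geodesic_from_uniq _ (geodesic_path_from cP) (geodesic_path_from dP)).
    by rewrite r0 ltW.
  by case: cP => _ -> _; case: dP => _ ->.
move=> [xi [xi0 xia ->]] [zeta [zeta0 zetaa ->]].
by apply: asymptotic_rays_eq => //; [rewrite xi0|apply/ray_classP; rewrite xia].
Qed.

Lemma cone_nbhd_lt alpha x r e c d : 0 <= r -> cone_nbhd alpha r e x ->
  path_to (inr alpha : bordification x0) c -> path_to x d -> mdist (c r) (d r) < e.
Proof.
move=> r0 [xr [c' [d' [c'P d'P]]]] + cP dP.
by rewrite (path_to_uniq r0 _ c'P cP)// (path_to_uniq r0 xr d'P dP).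
Qed.

Lemma cone_nbhd_center alpha r e : 0 < e -> cone_nbhd alpha r e (inr alpha : bordification x0).
Proof.
move=> e0; split=> //; have [c cP] := path_to_exists (inr alpha).
by exists c, c; rewrite mdistxx.
Qed.

(** Closeness at distance [r] from the basepoint is implied by closeness farther
    out, with a gain: the slack [1 - d(c r, c' r)] absorbs a unit error made at a
    large enough distance. *)
Lemma cone_nbhd_open alpha r : 0 < r -> open (cone_nbhd alpha r 1 : set (bordification x0)).
Proof.
move=> r0; split.
  rewrite openE => p [pr [c1 [d [c1P dP cd]]]].
  set D := mdist _ _ in cd.
  have rp : r < mdist x0 p by have /negP := pr p erefl; rewrite /cball /= -ltNge.
  pose e := Num.min (mdist x0 p - r) ((1 - D) / 2).
  have e0 : 0 < e by rewrite lt_min subr_gt0 rp /= divr_gt0// subr_gt0.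
  rewrite /interior; apply/nbhs_ballP; exists e => //= q.
  rewrite ballEmdist /= lt_min => /andP[pq1 pq2].
  have rq : r < mdist x0 q.
    have := metric_triangle x0 q p; rewrite (metric_sym q p); lra.
  split=> [_ [<-]|]; first by apply/negP; rewrite -ltNge.
  have [d' d'P] := cat0_geodesic x0 q; exists c1, d'; split=> //.
  have H := cat0_fan_min (ltW r0) (ltW rp) (ltW rq)
    (geodesic_path_from dP) (geodesic_path_from d'P).
  have [_ dp _] := dP; have [_ dq _] := d'P.
  rewrite dp dq in H.
  have : r * mdist (d r) (d' r) <= r * (2 * mdist p q).
    rewrite mulrA (mulrC r 2); apply: le_trans H; apply: ler_wpM2r; first exact: mdist_ge0.
    by rewrite le_min !ltW.
  rewrite ler_pM2l// => h; have := metric_triangle (c1 r) (d r) (d' r).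
  rewrite -/D; lra.
move=> beta [_ [c1 [d [c1P dP cd]]]].
set D := mdist _ _ in cd.
have D1 : 0 < 1 - D by rewrite subr_gt0.
pose r' := r / (1 - D).
have r'0 : 0 < r' by rewrite divr_gt0.
have rr' : r <= r'.
  rewrite ler_pdivlMr// ler_piMr ?(ltW r0)//; have := mdist_ge0 (c1 r) (d r).
  rewrite -/D; lra.
exists r' => // x bx; have [xr [_ [d' [_ d'P _]]]] := bx.
have xr' p : x = inl p -> ~ cball x0 r p.
  by move=> /xr + h; apply; apply: le_trans rr'.
split=> //; exists c1, d'; split=> //.
have dd := cone_nbhd_lt (ltW r'0) bx dP d'P.
have rr : 0 <= r <= r' by rewrite (ltW r0).
have := cat0_fan_scaled rr (path_to_from (ltW r'0) dP _) (path_to_from (ltW r'0) d'P xr).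
move=> /(_ _)/wrap[//|H].
have h : mdist (d r) (d' r) < 1 - D.
  rewrite -(ltr_pM2l r'0) divfK ?gt_eqF//; apply: le_lt_trans H _.
  by rewrite gtr_pMr.
have := metric_triangle (c1 r) (d r) (d' r); rewrite -/D; lra.
Qed.

Lemma nbhs_boundaryP alpha (U : set (bordification x0)) :
  nbhs (inr alpha : bordification x0) U <->
  exists2 r, 0 < r & cone_nbhd alpha r 1 `<=` U.
Proof.
split=> [|[r r0 rU]].
  rewrite nbhsE => -[V [Vo Va] VU]; have [r r0 rV] := Vo.2 alpha Va.
  by exists r => //; exact: subset_trans VU.
apply: (filterS rU); apply: open_nbhs_nbhs; split; first exact: cone_nbhd_open.
exact: cone_nbhd_center.
Qed.

Lemma cvg_boundaryP (I : Type) (F : set_system I) {FF : Filter F}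
    (f : I -> bordification x0) alpha :
  f @ F --> (inr alpha : bordification x0) <->
  forall r, 0 < r -> F [set i | cone_nbhd alpha r 1 (f i)].
Proof.
split=> [fa r r0|H U /nbhs_boundaryP[r r0 rU]].
  by apply: fa; apply/nbhs_boundaryP; exists r.
by apply: filterS (H r r0) => i; exact: rU.
Qed.

Lemma cvg_boundary_uniq (I : Type) (F : set_system I) {FF : ProperFilter F}
    (f : I -> bordification x0) alpha beta :
  f @ F --> (inr alpha : bordification x0) ->
  f @ F --> (inr beta : bordification x0) -> alpha = beta.
Proof.
move=> /cvg_boundaryP fa /cvg_boundaryP fb.
have [xi xi0 xia] := asymptotic_ray_from x0 alpha.
have [zeta zeta0 zetaa] := asymptotic_ray_from x0 beta.
rewrite -xia -zetaa; apply/ray_classP/(@asymptotic_bounded _ _ _ _ (1 + 1)) => r.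
rewrite le_eqVlt => /predU1P[<-|r0]; first by rewrite xi0 zeta0 mdistxx.
have [i [ai bi]] := filter_ex (filterI (fa r r0) (fb r r0)).
have [c cP] := path_to_exists (f i).
have h1 : mdist (xi r) (c r) < 1.
  by apply: (cone_nbhd_lt (ltW r0) ai _ cP); exists xi.
have h2 : mdist (zeta r) (c r) < 1.
  by apply: (cone_nbhd_lt (ltW r0) bi _ cP); exists zeta.
have := metric_triangle (xi r) (c r) (zeta r).
rewrite (metric_sym (c r)); lra.
Qed.


End Cone.

(** * Orbits of geometric actions *)

Lemma act_dist (R : realType) (G : groupType) (X : metricType R)
    (a : isometric_action G X) (x y : X) g h :
  mdist (a g x) (a h y) = mdist x (a (g^-1 * h)%g y).
Proof. by rewrite -(act_isom a g^-1%g) -!actM mulVg act1. Qed.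

Section Orbits.
Context {R : realType} {G : groupType} {X : cat0Type R} (a : isometric_action G X).

(** Were there infinitely many such [g], the orbit points [a g x] would converge
    along an ultrafilter containing no finite set, although only finitely many of
    them lie in a ball witnessing properness at their limit. *)
Lemma orbit_ball_finite (x : X) (r : R) :
  proper_action a -> finite_set [set g | mdist x (a g x) <= r].
Proof.
move=> propa; set S := [set g | _]; apply: contrapT => Sinf.
(* the filter of the sets containing almost all of S *)
pose F := [set A : set G | finite_set (S `\` A)].
have FP : ProperFilter F.
  apply: Build_ProperFilter_ex => [A FA|].
    apply: contrapT => A0; apply: Sinf; apply: sub_finite_set FA => g Sg.
    by split=> // Ag; apply: A0; exists g.
  split; first by rewrite /F /= setDT; exact: finite_set0.
    by move=> A B; rewrite /F /= setDIr => fA fB; rewrite finite_setU.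
  by move=> A B AB; apply: sub_finite_set; exact: setDS.
have [U [UU FU]] := ultraFilterLemma FP.
have [|z zP] := @ultra_compact_cvg _ _ U UU (fun g => a g x) _ (cat0_proper x r).
  by apply: FU; rewrite /F /= setDv; exact: finite_set0.
have [rho rho0 zfin] := propa z.
pose V := [set g | mdist z (a g x) < rho].
have UV : U V by exact: metricType_numDomainType.cvgr_dist_lt zP rho rho0.
have Vfin : finite_set V.
  have [->|/set0P[g0 zg0]] := eqVneq V set0; first exact: finite_set0.
  apply: sub_finite_set (finite_image (fun h => h * g0)%g zfin) => g zg.
  exists (g * g0^-1)%g; last by rewrite mulgVK.
  exists (a g x); split; last exact: ltW zg.
  by exists (a g0 x); [exact: ltW zg0|rewrite -actM mulgVK].
have UVc : U (~` V).
  by apply: FU; rewrite /F /= setDE setCK; exact: finite_setIr.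
by have [g []] := filter_ex (filterI UV UVc).
Qed.

End Orbits.

Definition coarsely_lipschitz (R : realType) (G : groupType) (X Y : metricType R)
    (aX : isometric_action G X) (aY : isometric_action G Y) (x0 : X) (y0 : Y)
    (L C : R) : Prop :=
  forall g h, mdist (aY g y0) (aY h y0) <= L * mdist (aX g x0) (aX h x0) + C.

(** A geodesic from [g x0] to [h x0] is followed by a chain of orbit points at
    unit steps; the steps come from a finite subset of the group, so they move
    [y0] by a bounded amount. *)
Lemma orbit_map_coarsely_lipschitz (R : realType) (G : groupType) (X : cat0Type R)
    (Y : metricType R) (aX : isometric_action G X) (aY : isometric_action G Y)
    (x0 : X) (y0 : Y) (N : R) :
  0 <= N -> proper_action aX -> translates aX (cball x0 N) = setT ->
  exists2 L, 0 <= L & coarsely_lipschitz aX aY x0 y0 L (2 * L).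
Proof.
move=> N0 propX cover.
have near p : exists b, mdist (aX b x0) p <= N.
  have : [set: X] p by []; rewrite -cover => -[b _ [q xq <-]].
  by exists b; rewrite act_isom.
have /finite_seqP[s sE] := orbit_ball_finite x0 (2 * N + 1) propX.
pose L := \big[Num.max/0]_(f <- s) mdist y0 (aY f y0).
have L0 : 0 <= L by exact: bigmax_ge_id.
have LP b h : mdist (aX b x0) (aX h x0) <= 2 * N + 1 ->
    mdist (aY b y0) (aY h y0) <= L.
  rewrite (act_dist aX) (act_dist aY) => bh.
  have bhs : (b^-1 * h)%g \in s.
    have : [set g | mdist x0 (aX g x0) <= 2 * N + 1] (b^-1 * h)%g by [].
    by rewrite sE.
  exact: (le_bigmax_seq 0 _ xpredT (fun f => mdist y0 (aY f y0))).
have chain n : forall b p h, mdist (aX b x0) p <= N -> mdist p (aX h x0) <= n%:R ->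
    mdist (aY b y0) (aY h y0) <= L * n.+1%:R.
  elim: n => [|n IH] b p h bp ph.
    by rewrite mulr1 LP//; have := metric_triangle (aX b x0) p (aX h x0); lra.
  have [c cP] := cat0_geodesic p (aX h x0); have cF := geodesic_path_from cP.
  have [ph1|ph1] := leP (mdist p (aX h x0)) 1.
    apply: (@le_trans _ _ L); last by rewrite ler_peMr// ler1n.
    by rewrite LP//; have := metric_triangle (aX b x0) p (aX h x0); lra.
  have [b' b'c] := near (c 1).
  have pc : mdist p (c 1) = 1 by rewrite (geodesic_from_dist0 cF)// ler01 ltW.
  have ch : mdist (c 1) (aX h x0) <= n%:R.
    have [_ <- _] := cP; rewrite (geodesic_from_dist cF) ?ler01 ?mdist_ge0 ?lexx ?(ltW ph1)//.
    by rewrite distrC gtr0_norm ?subr_gt0// lerBlDr natr1.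
  have := IH b' _ h b'c ch.
  have : mdist (aY b y0) (aY b' y0) <= L.
    apply: LP; have := metric_triangle (aX b x0) p (aX b' x0).
    have := metric_triangle p (c 1) (aX b' x0).
    rewrite (metric_sym (c 1) (aX b' x0)); lra.
  have := metric_triangle (aY b y0) (aY b' y0) (aY h y0).
  rewrite -[n.+2%:R]natr1 mulrDr mulr1; lra.
exists L => // g h; set d := mdist (aX g x0) (aX h x0).
have d0 : 0 <= d := mdist_ge0 _ _.
have /andP[tr1 tr2] := truncn_itv d0.
have gg : mdist (aX g x0) (aX g x0) <= N by rewrite mdistxx.
apply: le_trans (chain _ g _ h gg (ltW tr2)) _.
by rewrite (mulrC 2) -mulrDr ler_wpM2l// -natr1 -natr1; lra.
Qed.

(** * Geodesics that fellow-travel along the orbits *)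

Section Tracking.
Context {R : realType} {G : groupType} {X Y : cat0Type R}.
Variables (aX : isometric_action G X) (aY : isometric_action G Y) (x0 : X) (y0 : Y).
Implicit Types (K L C l r s t : R).

Definition shadowed K (p : X) l (eta : R -> Y) : Prop :=
  exists b t, [/\ 0 <= t <= l, mdist p (aX b x0) <= K & mdist (aY b y0) (eta t) <= K].

(** Asking only for some [b] near [c s], rather than for all of them, makes the
    condition symmetric in the two spaces up to the value of [K]. *)
Definition orbit_tracking K : Prop :=
  forall g c eta, geodesic_path x0 (aX g x0) c -> geodesic_path y0 (aY g y0) eta ->
  forall s, 0 <= s <= mdist x0 (aX g x0) ->
  shadowed K (c s) (mdist y0 (aY g y0)) eta.

Lemma shadowed_le K K' p l eta : K <= K' -> shadowed K p l eta -> shadowed K' p l eta.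
Proof.
move=> KK [b [t [tl pb bt]]]; exists b, t; split=> //; exact: le_trans KK.
Qed.

Lemma orbit_tracking_of_segments N M :
  translates aX (cball x0 N) = setT ->
  (forall g a : G,
    geodesic_segment x0 (aX g x0) `&` cball (aX a x0) N !=set0 ->
    geodesic_segment y0 (aY g y0) `&` cball (aY a y0) M !=set0) ->
  orbit_tracking (Num.max N M).
Proof.
move=> cover seg g c eta cP etaP s s0.
have : [set: X] (c s) by []; rewrite -cover => -[b _ [q xq bq]].
have bc : mdist (aX b x0) (c s) <= N by rewrite -bq act_isom.
have [|z [[eta' eta'P [t tl <-]] bt]] := seg g b.
  by exists (c s); split=> //; exists c => //; exists s; rewrite ?in_itv.
rewrite in_itv /= in tl.
have e : eta t = eta' t.
  apply: (geodesic_from_uniq tl (geodesic_path_from etaP) (geodesic_path_from eta'P)).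
  by case: etaP => _ -> _; case: eta'P => _ -> _.
exists b, t; split=> //.
  by rewrite metric_sym le_max bc.
by rewrite e le_max; move: bt; rewrite /cball /= => ->; rewrite orbT.
Qed.

End Tracking.

(** As [c] is traversed in unit steps, the times at which its shadows lie on [eta]
    move by bounded steps from near 0 to near the length of [eta]; so they leave no
    large gap. *)
Lemma orbit_tracking_sym (R : realType) (G : groupType) (X Y : cat0Type R)
    (aX : isometric_action G X) (aY : isometric_action G Y) (x0 : X) (y0 : Y)
    (K L C : R) : 0 <= L -> 0 <= C ->
  coarsely_lipschitz aX aY x0 y0 L C ->
  orbit_tracking aX aY x0 y0 K -> exists K', orbit_tracking aY aX y0 x0 K'.
Proof.
move=> L0 C0 lip track; pose J := 2 * K + L * (2 * K + 1) + C.
(* J bounds the steps between the times of consecutive shadows *)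
exists (K + J) => g eta c etaP cP u /andP[u0 ul].
set lX := mdist x0 (aX g x0); set lY := mdist y0 (aY g y0) in ul.
have lX0 : 0 <= lX := mdist_ge0 _ _.
have cF := geodesic_path_from cP; have etaF := geodesic_path_from etaP.
pose m k := Num.min k%:R lX.
have mP k : 0 <= m k <= lX by rewrite le_min ler0n lX0 ge_min lexx orbT.
have /choice[b /choice[t btP]] : forall k, exists b t,
    [/\ 0 <= t <= lY, mdist (c (m k)) (aX b x0) <= K & mdist (aY b y0) (eta t) <= K].
  by move=> k; exact: (track g c eta cP etaP (m k) (mP k)).
have K0 : 0 <= K by have [_ h _] := btP 0%N; exact: le_trans (mdist_ge0 _ _) h.
have LK : L * K <= L * (2 * K + 1) by apply: ler_wpM2l => //; lra.
have step k : t k.+1 <= t k + J.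
  have [tk ck ek] := btP k; have [tk1 ck1 ek1] := btP k.+1.
  have h : mdist (eta (t k)) (eta (t k.+1)) <= J.
    have h1 := lip (b k) (b k.+1).
    have h2 : mdist (aX (b k) x0) (aX (b k.+1) x0) <= 2 * K + 1.
      have h3 : mdist (c (m k)) (c (m k.+1)) <= 1.
        rewrite (geodesic_from_dist cF)// /m -natr1 ler_norml.
        by case: (leP k%:R lX) => ?; case: (leP (k%:R + 1) lX) => ?; lra.
      have := metric_triangle (aX (b k) x0) (c (m k)) (aX (b k.+1) x0).
      have := metric_triangle (c (m k)) (c (m k.+1)) (aX (b k.+1) x0).
      rewrite (metric_sym (aX (b k) x0) (c (m k))); lra.
    have h4 : L * mdist (aX (b k) x0) (aX (b k.+1) x0) <= L * (2 * K + 1).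
      exact: ler_wpM2l.
    have := metric_triangle (eta (t k)) (aY (b k) y0) (eta (t k.+1)).
    have := metric_triangle (aY (b k) y0) (aY (b k.+1) y0) (eta (t k.+1)).
    by rewrite (metric_sym (eta (t k)) (aY (b k) y0)) /J; lra.
  by move: h; rewrite (geodesic_from_dist etaF)// ler_norml; lra.
(* it suffices to find a shadow near the time u *)
suff [k tk] : exists k, `|t k - u| <= J.
  have [tl ck ek] := btP k; exists (b k), (m k); split=> //.
    have := metric_triangle (eta u) (eta (t k)) (aY (b k) y0).
    rewrite (geodesic_from_dist etaF) ?u0// (metric_sym (eta (t k)) (aY _ _)) distrC; lra.
  by rewrite metric_sym; apply: le_trans ck _; rewrite lerDl; apply: le_trans tk.
have t0J : t 0%N <= J.
  have [t0 c0 e0] := btP 0%N.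
  have := geodesic_from_dist0 etaF t0.
  have := metric_triangle y0 (aY (b 0%N) y0) (eta (t 0%N)).
  have := lip 1%g (b 0%N); rewrite !act1.
  move: c0; rewrite {1}/m min_l// cF.1 => c0.
  have : L * mdist x0 (aX (b 0%N) x0) <= L * K by exact: ler_wpM2l.
  rewrite /J; lra.
have J0 : 0 <= J by rewrite /J !addr_ge0// mulr_ge0//; lra.
have [[k uk]|nou] := pselect (exists k, u <= t k).
  have [[|j] uj minj] := ex_minnP (ex_intro (fun k => u <= t k) k uk).
    by exists 0%N; rewrite ler_norml; lra.
  exists j.+1; have := step j.
  have : t j < u by rewrite ltNge; apply/negP => /minj; rewrite ltnn.
  by rewrite ler_norml; lra.
pose n := (Num.Def.trunc lX).+1; exists n.
have nl : lX <= n%:R by have /andP[_ /ltW] := truncn_itv lX0.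
have [tn cn en] := btP n.
have tu : t n < u by rewrite ltNge; apply/negP => h; apply: nou; exists n.
have cl : c (m n) = aX g x0 by rewrite /m min_r//; case: cP.
have el : eta lY = aY g y0 by case: etaP.
have lY0 : 0 <= lY <= lY by rewrite mdist_ge0 lexx.
have h1 := geodesic_from_dist etaF lY0 tn.
have h2 := metric_triangle (aY g y0) (aY (b n) y0) (eta (t n)).
have h3 := lip g (b n).
have h4 : L * mdist (aX g x0) (aX (b n) x0) <= L * K.
  by apply: ler_wpM2l => //; rewrite -cl.
move: h1; rewrite el ger0_norm => [h1|]; last by lra.
by rewrite ler_norml; move: h1 h2 h3 h4 en tu ul LK; rewrite /J; lra.
Qed.

(** * The induced map between the boundaries *)

Lemma cvg_along_ray (R : realType) (X : cat0Type R) (xi : ray X) (p : nat -> X) (N : R) :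
  (forall n, mdist (xi n%:R) (p n) <= N) ->
  (inl (p n) : bordification (xi 0)) @[n --> \oo] -->
  (inr (ray_class xi) : bordification (xi 0)).
Proof.
move=> near; apply/cvg_boundaryP => r r0.
have N0 : 0 <= N := le_trans (mdist_ge0 _ _) (near 0%N).
apply: filterS (nbhs_infty_ger (r + N + 2 * r * N + 1)) => n nr.
have rN : 0 <= 2 * r * N by rewrite !mulr_ge0// ltW.
have xn : mdist (xi 0) (xi n%:R) = n%:R.
  by rewrite (geodesic_from_dist0 (ray_geodesic_from xi n%:R))// ler0n lexx.
have pn : r + 2 * r * N < mdist (xi 0) (p n).
  have := metric_triangle (xi 0) (p n) (xi n%:R).
  by have := near n; rewrite (metric_sym (xi n%:R) (p n)) xn; lra.
split=> [_ [<-]|]; first by apply/negP; rewrite -ltNge; lra.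
have [c cP] := cat0_geodesic (xi 0) (p n); exists xi, c; split=> //; first by exists xi.
apply: (cat0_fan_lt (ltW r0) _ _ (ray_geodesic_from xi n%:R) (geodesic_path_from cP) (D := N)); try lra.
by have [_ -> _] := cP; exact: near.
Qed.

Section BoundaryMap.
Context {R : realType} {G : groupType} {X Y : cat0Type R}.
Variables (aX : isometric_action G X) (aY : isometric_action G Y) (x0 : X) (y0 : Y).
Variables (L C N K : R).
Implicit Types k r s t S : R.
Hypotheses (L_gt0 : 0 < L) (C_ge0 : 0 <= C) (N_ge0 : 0 <= N) (K_ge0 : 0 <= K).
Hypothesis lipXY : coarsely_lipschitz aX aY x0 y0 L C.
Hypothesis lipYX : coarsely_lipschitz aY aX y0 x0 L C.
Hypothesis coverX : translates aX (cball x0 N) = setT.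
Hypothesis track : orbit_tracking aX aY x0 y0 K.

(** Shadows of two nearby points far from [x0] are boundedly close to each other
    and far from [y0], so the two geodesics carrying them are close at [r]. *)
Lemma shadows_close k r : 0 <= k -> 0 <= r ->
  exists2 S, 0 < S & forall p p' l l' eta eta',
    S <= mdist x0 p -> S <= mdist x0 p' -> mdist p p' <= 1 ->
    geodesic_from y0 l eta -> geodesic_from y0 l' eta' ->
    shadowed aX aY x0 y0 k p l eta -> shadowed aX aY x0 y0 k p' l' eta' ->
    [/\ r < l, r < l' & mdist (eta r) (eta' r) < 1].
Proof.
move=> k0 r0; have C0 := C_ge0.
pose D := 2 * k + L * (2 * k + 1) + C.
have Lk : 0 <= L * (2 * k + 1) by rewrite mulr_ge0 ?(ltW L_gt0)//; lra.
have D0 : 0 <= D by rewrite /D; lra.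
have rD : 0 <= 2 * r * D by rewrite !mulr_ge0.
pose T := r + 2 * r * D + 1.
(* T is large enough for the fan estimate at r; by lipYX, a point at distance L T + O(1)
   from x0 has its shadows at time at least T *)
exists (L * (T + k) + C + k).
  have : 0 < L * (T + k) by rewrite mulr_gt0// /T; lra.
  lra.
have far p b l eta t : L * (T + k) + C + k <= mdist x0 p -> geodesic_from y0 l eta ->
    0 <= t <= l -> mdist p (aX b x0) <= k -> mdist (aY b y0) (eta t) <= k -> T <= t.
  move=> Sp etaP tl pb bt.
  have h1 := metric_triangle x0 (aX b x0) p.
  have h2 := lipYX 1%g b; rewrite !act1 in h2.
  have h3 := metric_triangle y0 (eta t) (aY b y0).
  rewrite (geodesic_from_dist0 etaP tl) (metric_sym (eta t) (aY b y0)) in h3.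
  rewrite (metric_sym (aX b x0) p) in h1.
  have h4 : L * mdist y0 (aY b y0) <= L * (t + k) by rewrite ler_wpM2l ?(ltW L_gt0)//; lra.
  have : L * (T + k) <= L * (t + k) by lra.
  by rewrite ler_pM2l//; lra.
move=> p p' l l' eta eta' Sp Sp' pp' etaP eta'P [b [t [tl pb bt]]] [b' [t' [tl' pb' bt']]].
have Tt := far _ _ _ _ _ Sp etaP tl pb bt.
have Tt' := far _ _ _ _ _ Sp' eta'P tl' pb' bt'.
move: (tl) (tl') => /andP[_ tl1] /andP[_ tl1']; rewrite /T in Tt Tt'.
split; [lra|lra|].
apply: (cat0_fan_lt r0 _ _ (geodesic_from_le tl1 etaP) (geodesic_from_le tl1' eta'P)
  (D := D)); try lra.
have h1 := lipXY b b'.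
have h2 : mdist (aX b x0) (aX b' x0) <= 2 * k + 1.
  have := metric_triangle (aX b x0) p (aX b' x0).
  have := metric_triangle p p' (aX b' x0).
  by rewrite (metric_sym (aX b x0) p); lra.
have h3 : L * mdist (aX b x0) (aX b' x0) <= L * (2 * k + 1) by rewrite ler_wpM2l// ltW.
have := metric_triangle (eta t) (aY b y0) (eta' t').
have := metric_triangle (aY b y0) (aY b' y0) (eta' t').
by rewrite (metric_sym (eta t) (aY b y0)) /D; lra.
Qed.

(** The length [l] varies with [s], as a ray has shadows at arbitrarily large times. *)
Definition ray_shadow k (xi : ray X) (eta : ray Y) : Prop :=
  forall s, 0 <= s -> exists l, shadowed aX aY x0 y0 k (xi s) l eta.

Lemma ray_shadow_asymptotic k (xi xi' : ray X) (eta eta' : ray Y) :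
  ray_shadow k xi eta -> asymptotic xi' xi -> asymptotic eta eta' ->
  exists k', ray_shadow k' xi' eta'.
Proof.
move=> sh [A AP] [B BP]; exists (k + A + B) => s /AP[t t0 st].
have [l [b [u [/andP[u0 _] tb bu]]]] := sh t t0.
have [v v0 uv] := BP u u0; exists v, b, v.
have A0 := le_trans (mdist_ge0 _ _) st.
have B0 := le_trans (mdist_ge0 _ _) uv.
split; first by rewrite v0 lexx.
  by have := metric_triangle (xi' s) (xi t) (aX b x0); lra.
by have := metric_triangle (aY b y0) (eta u) (eta' v); lra.
Qed.

(** The estimate applies to a point of [xi] and itself, which has shadows on both
    rays. *)
Lemma ray_shadow_uniq k k' (xi : ray X) (eta eta' : ray Y) :
  eta 0 = y0 -> eta' 0 = y0 -> ray_shadow k xi eta -> ray_shadow k' xi eta' ->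
  ray_class eta = ray_class eta'.
Proof.
move=> e0 e'0 sh sh'; pose m := Num.max 0 (Num.max k k').
have m0 : 0 <= m by rewrite le_max lexx.
apply/ray_classP/(@asymptotic_bounded _ _ _ _ 1) => r r0.
have [S S0 close] := shadows_close m0 r0.
pose s := S + mdist (xi 0) x0.
have s0 : 0 <= s by rewrite addr_ge0 ?mdist_ge0// ltW.
have Ss : S <= mdist x0 (xi s).
  have := metric_triangle (xi 0) x0 (xi s).
  by rewrite (geodesic_from_dist0 (ray_geodesic_from xi s)) ?s0 ?lexx// /s; lra.
have [l lP] := sh s s0; have [l' l'P] := sh' s s0.
have etaP := ray_geodesic_from eta l; have eta'P := ray_geodesic_from eta' l'.
rewrite e0 in etaP; rewrite e'0 in eta'P.
have km : k <= m by rewrite !le_max lexx orbT.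
have km' : k' <= m by rewrite !le_max lexx !orbT.
have xx : mdist (xi s) (xi s) <= 1 by rewrite mdistxx.
by have [_ _ /ltW] := close _ _ _ _ _ _ Ss Ss xx etaP eta'P
  (shadowed_le km lP) (shadowed_le km' l'P).
Qed.

(** The shadow of [xi] is a limit of the geodesics from [y0] to [g n y0], where
    the [g n x0] follow [xi]. *)
Lemma ray_shadow_exists : exists2 k, 0 <= k &
  forall xi : ray X, xi 0 = x0 -> exists2 eta : ray Y, eta 0 = y0 & ray_shadow k xi eta.
Proof.
have [C0 N0 K0] := And3 C_ge0 N_ge0 K_ge0.
exists (K + 2 * N + 1) => [|xi xi0]; first by rewrite !addr_ge0// mulr_ge0.
have /choice[g gP] : forall n, exists g, mdist (xi n%:R) (aX g x0) <= N.
  move=> n; have : [set: X] (xi n%:R) by [].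
  by rewrite -coverX => -[g _ [q xq <-]]; exists g; rewrite metric_sym act_isom.
pose d n := mdist x0 (aX (g n) x0).
pose l n := mdist y0 (aY (g n) y0).
have xn n : mdist x0 (xi n%:R) = n%:R.
  by rewrite -xi0 (geodesic_from_dist0 (ray_geodesic_from xi n%:R))// ler0n lexx.
have dn n : n%:R - N <= d n.
  have := metric_triangle x0 (aX (g n) x0) (xi n%:R).
  by rewrite (metric_sym (aX (g n) x0)) xn -/(d n); have := gP n; lra.
have dl n : d n <= L * l n + C by have := lipYX 1%g (g n); rewrite !act1.
have ld n : l n <= L * d n + C by have := lipXY 1%g (g n); rewrite !act1.
have /choice[c cP] n := cat0_geodesic x0 (aX (g n) x0).
have /choice[e eP] n := cat0_geodesic y0 (aY (g n) y0).
have [|eta eta0 etaP] := geodesics_subconverge (fun n => geodesic_path_from (eP n)).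
  move=> r; apply: filterS (nbhs_infty_ger (L * r + C + N)) => n nr.
  by rewrite -(ler_pM2l L_gt0) -/(l n); have := dn n; have := dl n; lra.
exists eta => // s s0.
(* an upper bound for the times of the shadows of points at distance s from x0 *)
pose T := K + L * (s + K) + C.
have T0 : 0 <= T by rewrite !addr_ge0// mulr_ge0 ?(ltW L_gt0)// addr_ge0.
have [n [ns Tl eT]] := etaP T _ T0 (nbhs_infty_ger (s + N + 1)).
have dns := dn n.
have sd : 0 <= s <= d n by rewrite s0 /=; lra.
have [b [t [/andP[t0 tl] cb bt]]] := track (cP n) (eP n) sd.
have tT : t <= T.
  have h1 := geodesic_from_dist0 (geodesic_path_from (eP n)) (t := t).
  have {}h1 : mdist y0 (e n t) = t by apply: h1; rewrite t0.
  have h2 := metric_triangle y0 (aY b y0) (e n t).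
  have h3 := lipXY 1%g b; rewrite !act1 in h3.
  have h4 := metric_triangle x0 (c n s) (aX b x0).
  rewrite (geodesic_from_dist0 (geodesic_path_from (cP n)) sd) in h4.
  have : L * mdist x0 (aX b x0) <= L * (s + K) by rewrite ler_wpM2l ?(ltW L_gt0)//; lra.
  by rewrite /T; lra.
exists T, b, t; split; first by rewrite t0.
  have h : mdist (xi s) (c n s) <= 2 * N.
    have sn : s <= n%:R by lra.
    have xiF := ray_geodesic_from xi n%:R; rewrite xi0 in xiF.
    have := cat0_fan_min s0 sn (proj2 (andP sd)) xiF (geodesic_path_from (cP n)).
    have [_ -> _] := cP n; set m := Num.min _ _ => H.
    have m0 : 0 < m by rewrite lt_min; apply/andP; split; lra.
    have sm : s <= m by rewrite le_min sn; case/andP: sd.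
    rewrite -(ler_pM2l m0); apply: le_trans H _.
    rewrite mulrCA -mulrA ler_pM2l// ; apply: ler_pM => //; exact: mdist_ge0.
  by have := metric_triangle (xi s) (c n s) (aX b x0); lra.
have h : mdist (e n t) (eta t) < 1.
  rewrite metric_sym; apply: le_lt_trans eT.
  have etaF := ray_geodesic_from eta T; rewrite eta0 in etaF.
  have eF := geodesic_from_le Tl (geodesic_path_from (eP n)).
  by apply: cat0_fan => //; [rewrite eta0 eF.1|exact: etaF.2|exact: eF.2].
by have := metric_triangle (aY b y0) (e n t) (eta t); lra.
Qed.

(** For the equivariance, the translate by [g] of a shadowing pair of rays shadows,
    and has to be compared with the pair based at [x0] and [y0]: the change of
    origins only affects the constant. *)
Lemma boundary_map_exists : exists phi : cone_boundary x0 -> cone_boundary y0,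
  boundary_equivariant aX aY phi /\ continuous_extension aX aY phi.
Proof.
have [k k0 shadow] := ray_shadow_exists.
have /choice[phi phiP] : forall alpha : boundary X, exists beta : boundary Y,
    exists (xi : ray X) (eta : ray Y), [/\ xi 0 = x0 /\ ray_class xi = alpha,
      eta 0 = y0 /\ ray_class eta = beta & ray_shadow k xi eta].
  move=> alpha; have [xi xi0 xia] := asymptotic_ray_from x0 alpha.
  by have [eta eta0 sh] := shadow xi xi0; exists (ray_class eta), xi, eta.
pose k' := Num.max k K.
have kk' : k <= k' by rewrite le_max lexx.
have Kk' : K <= k' by rewrite le_max lexx orbT.
have k'0 : 0 <= k' := le_trans k0 kk'.
exists phi; split.
  move=> g alpha.
  have [xi [eta [[xi0 xia] [eta0 <-] sh]]] := phiP alpha.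
  have [xi' [eta' [[xi'0 xi'a] [eta'0 <-] sh']]] := phiP (boundary_act aX g alpha).
  have [zeta zeta0 zetaa] := asymptotic_ray_from y0 (boundary_act aY g (ray_class eta)).
  have gsh : ray_shadow k (ray_act aX g xi) (ray_act aY g eta).
    move=> s /sh[l [b [t [tl pb bt]]]]; exists l, (g * b)%g, t.
    by rewrite !actM !act_isom.
  rewrite -xia boundary_act_class in xi'a; rewrite boundary_act_class in zetaa *.
  have /ray_classP asX := xi'a; have /esym/ray_classP asY := zetaa.
  have [m msh] := ray_shadow_asymptotic gsh asX asY.
  by rewrite -zetaa; exact: ray_shadow_uniq eta'0 zeta0 sh' msh.
(* continuity and extension are one estimate, at boundary points and at orbit points *)
have phi_near alpha r : 0 < r -> exists2 S, 0 < S &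
    (forall beta, cone_nbhd alpha S 1 (inr beta : bordification x0) ->
      cone_nbhd (phi alpha) r 1 (inr (phi beta) : bordification y0)) /\
    (forall g, cone_nbhd alpha S 1 (inl (aX g x0) : bordification x0) ->
      cone_nbhd (phi alpha) r 1 (inl (aY g y0) : bordification y0)).
  move=> r0; have [S S0 close] := shadows_close k'0 (ltW r0); exists S => //.
  have [xi [eta [[xi0 xia] [eta0 etaa] sh]]] := phiP alpha.
  have xiP : path_to (inr alpha : bordification x0) xi by exists xi.
  have [l lP] := sh S (ltW S0).
  have xiS : S <= mdist x0 (xi S).
    by rewrite -xi0 (geodesic_from_dist0 (ray_geodesic_from xi S)) ?lexx// ltW//=.
  have etaP := ray_geodesic_from eta l; rewrite eta0 in etaP.
  split=> [beta ab|g ag].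
    have [zeta [chi [[zeta0 zetab] [chi0 chib] sh']]] := phiP beta.
    have zetaP : path_to (inr beta : bordification x0) zeta by exists zeta.
    have zetaS : S <= mdist x0 (zeta S).
      by rewrite -zeta0 (geodesic_from_dist0 (ray_geodesic_from zeta S)) ?lexx// ltW//=.
    have [l' l'P] := sh' S (ltW S0).
    have chiP := ray_geodesic_from chi l'; rewrite chi0 in chiP.
    have [_ _ ec] := close _ _ _ _ _ _ xiS zetaS
      (ltW (cone_nbhd_lt (ltW S0) ab xiP zetaP)) etaP chiP
      (shadowed_le kk' lP) (shadowed_le kk' l'P).
    by split=> //; exists eta, chi; split=> //; [exists eta|exists chi].
  have [c cP] := cat0_geodesic x0 (aX g x0).
  have [chi chiP] := cat0_geodesic y0 (aY g y0).
  have Sg : S < mdist x0 (aX g x0).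
    by have [/(_ _ erefl)/negP] := ag; rewrite /cball /= -ltNge.
  have cS : S <= mdist x0 (c S).
    by rewrite (geodesic_from_dist0 (geodesic_path_from cP))// !ltW.
  have Sl : 0 <= S <= mdist x0 (aX g x0) by rewrite !ltW.
  have [_ rl ec] := close _ _ _ _ _ _ xiS cS
    (ltW (cone_nbhd_lt (ltW S0) ag xiP cP)) etaP (geodesic_path_from chiP)
    (shadowed_le kk' lP) (shadowed_le Kk' (track cP chiP Sl)).
  split=> [_ [<-]|]; first by apply/negP; rewrite -ltNge.
  by exists eta, chi; split=> //; exists eta.
split=> [|g alpha /cvg_boundaryP ga].
  apply: continuous_comp_initial => alpha.
  have FF : Filter (nbhs (alpha : cone_boundary x0)) by exact: nbhs_filter.
  apply/(cvg_boundaryP (F := nbhs (alpha : cone_boundary x0))) => r r0; have [S S0 [SP _]] := phi_near alpha r r0.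
  have inr_alpha : (inr : cone_boundary x0 -> bordification x0) @ (alpha : cone_boundary x0)
      --> (inr alpha : bordification x0) by exact: initial_continuous.
  have /(cvg_boundaryP (F := nbhs (alpha : cone_boundary x0)))/(_ S S0) := inr_alpha.
  by apply: filterS => beta; exact: SP.
apply/cvg_boundaryP => r r0; have [S S0 [_ SP]] := phi_near alpha r r0.
by apply: filterS (ga S S0) => i; exact: SP.
Qed.

End BoundaryMap.

(** The two extensions are mutually inverse because both are determined by the
    limits of the same sequences of group elements, and every boundary point is a
    limit of orbit points. *)
Lemma continuous_extension_cancel (R : realType) (G : groupType) (X Y : cat0Type R)
    (aX : isometric_action G X) (aY : isometric_action G Y) (x0 : X) (y0 : Y) (N : R)
    (phi : cone_boundary x0 -> cone_boundary y0)
    (psi : cone_boundary y0 -> cone_boundary x0) :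
  translates aX (cball x0 N) = setT ->
  continuous_extension aX aY phi -> continuous_extension aY aX psi ->
  cancel phi psi.
Proof.
move=> cover [_ phiE] [_ psiE] alpha.
have [xi xi0 xia] := asymptotic_ray_from x0 alpha.
have /choice[g gP] : forall n, exists g, mdist (xi n%:R) (aX g x0) <= N.
  move=> n; have : [set: X] (xi n%:R) by [].
  by rewrite -cover => -[g _ [q xq <-]]; exists g; rewrite metric_sym act_isom.
have ga := cvg_along_ray gP; rewrite xi0 xia in ga.
exact: cvg_boundary_uniq (psiE g _ (phiE g _ ga)) ga.
Qed.

Theorem theorem1p1 (R : realType) (G : groupType) (X Y : cat0Type R)
    (aX : isometric_action G X) (aY : isometric_action G Y)
    (geomX : geometric_action aX) (geomY : geometric_action aY)
    (x0 : X) (y0 : Y) (N M : R) (N_gt0 : 0 < N) (M_gt0 : 0 < M)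
    (coverX : translates aX (cball x0 N) = [set: X])
    (coverY : translates aY (cball y0 M) = [set: Y])
    (segXY : forall g a : G,
      geodesic_segment x0 (aX g x0) `&` cball (aX a x0) N !=set0 ->
      geodesic_segment y0 (aY g y0) `&` cball (aY a y0) M !=set0) :
  orbit_map_quasi_isometry aX aY x0 y0 /\
  exists phi : cone_boundary x0 -> cone_boundary y0,
    [/\ homeomorphism phi,
        boundary_equivariant aX aY phi &
        continuous_extension aX aY phi].
Proof.
have [A A0 lipA] := orbit_map_coarsely_lipschitz aY y0 (ltW N_gt0) geomX.1 coverX.
have [B B0 lipB] := orbit_map_coarsely_lipschitz aX x0 (ltW M_gt0) geomY.1 coverY.
pose L := A + B + 1; pose C := 2 * A + 2 * B.
have L1 : 1 <= L by rewrite /L; lra.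
have L0 : 0 < L by lra.
have C0 : 0 <= C by rewrite /C; lra.
have lipXY : coarsely_lipschitz aX aY x0 y0 L C.
  move=> g h; apply: le_trans (lipA g h) _; apply: lerD; last by rewrite /C; lra.
  by apply: ler_wpM2r; [exact: mdist_ge0|rewrite /L; lra].
have lipYX : coarsely_lipschitz aY aX y0 x0 L C.
  move=> g h; apply: le_trans (lipB g h) _; apply: lerD; last by rewrite /C; lra.
  by apply: ler_wpM2r; [exact: mdist_ge0|rewrite /L; lra].
split.
  exists L, C; split=> // g h; split; last exact: lipXY.
  rewrite lerBlDr ler_pdivrMl//; apply: le_trans (lipYX g h) _.
  by rewrite [leRHS]mulrDr lerD2l ler_peMl.
have trackXY := orbit_tracking_of_segments coverX segXY.
have [K trackYX] := orbit_tracking_sym (ltW L0) C0 lipXY trackXY.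
have max0 (a b : R) : 0 < a -> 0 <= Num.max a b by move=> a0; rewrite le_max ltW.
have [phi [phi_eq phi_ext]] :=
  boundary_map_exists L0 C0 (ltW N_gt0) (max0 _ M N_gt0) lipXY lipYX coverX trackXY.
have K0 : 0 <= K.
  have [e eP] := cat0_geodesic y0 (aY 1%g y0).
  have [c cP] := cat0_geodesic x0 (aX 1%g x0).
  have [|b [t [_ h _]]] := trackYX 1%g e c eP cP 0; first by rewrite lexx mdist_ge0.
  exact: le_trans (mdist_ge0 _ _) h.
have [psi [_ psi_ext]] :=
  boundary_map_exists L0 C0 (ltW M_gt0) K0 lipYX lipXY coverY trackYX.
exists phi; split=> //; split; first exact: phi_ext.1.
exists psi; split; last exact: psi_ext.1.
  exact: continuous_extension_cancel coverX phi_ext psi_ext.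
exact: continuous_extension_cancel coverY psi_ext phi_ext.
Qed.
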